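(* Let $T:I_0'\to I_0$ be an EMR transformation admitting an extension $\hat T$ with the extension, comparability and measure-comparability properties (E1), (E2), (E3) listed in the context, and let $\mu$ be an equilibrium state (a Gibbs measure) for a potential $\Phi$. Suppose that for $x\in I_0''$ the Markov pointwise dimension $\delta_\mu(x)$ and the Birkhoff average $\overline\Phi(x)$ exist. Then $\underline d_\mu(x)\ge\delta_\mu(x)$.
   Context: $I=[0,1]$ and $I_0\subset I$ is an interval. An EMR transformation is here a map $T:I_0'\to I_0$, where $I_0'=\bigcup_{i\in\mathbb N}I_{1,i}$ for disjoint intervals $I_{1,i}\subset I_0$, each $T:I_{1,i}\to I_0$ is a diffeomorphism, $\inf\{|DT(x)|:x\in I_0'\}>1$, and $T$ has bounded distortion: there is $K>0$ such that $|DT(x)/DT(y)-1|\le K|x-y|$ for all $i$ and $x,y\in I_{1,i}$. $I_0''=\{x\in I_0':T^n(x)\in I_0'\text{ for all }n\ge1\}$. If $T^n(x)$ is defined, $I_n(x)$ denotes the $n$-cylinder at $x$, i.e. the maximal interval around $x$ such that $T^n:I_n(x)\to I_0$ is a diffeomorphism; the $n$-cylinders are listed as $I_{n,1},I_{n,2},\dots$. $|\cdot|$ denotes Euclidean length. For an EMR transformation there is $K_1\ge1$ such that for all such $x,n$, $$\frac1{K_1}\le\frac{|I_n(x)|}{|DT^n(x)|^{-1}}\le K_1 .$$ Extension assumptions. Let $I_0^\ell,I_0^r\subset I$ be intervals adjacent to $I_0$ (on its left and right) and $\hat I_0:=I_0^\ell\cup I_0\cup I_0^r$. (E1) For all $n,i\in\mathbb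 N$ the map $T^n:I_{n,i}\to I_0$ has an extension $\hat T^n$ such that, for some interval $\hat I_{n,i}$ with $\hat I_0\supset\hat I_{n,i}\supset I_{n,i}$, the map $\hat T^n|_{\hat I_{n,i}}:\hat I_{n,i}\to\hat I_0$ is a diffeomorphism and $\hat T^n|_{I_{n,i}}=T^n|_{I_{n,i}}$. If $I_n(x)=I_{n,i}$, write $\hat I_n(x)=\hat I_{n,i}$, and let $I_n^\ell(x),I_n^r(x)$ be the left and right components of $\hat I_n(x)\setminus I_n(x)$. (E2) There exists $K_2\ge1$ such that for all $x,n$, $\frac1{K_2}\le\frac{|I_n^\ell(x)|}{|I_n(x)|},\ \frac{|I_n^r(x)|}{|I_n(x)|}\le K_2$. (E3) $\mu$ is defined on $\hat I_0$ and there exists $K_3\ge1$ such that for all $x,n$, $\frac1{K_3}\le\frac{\mu(\hat I_n(x))}{\mu(I_n(x))}\le K_3$. Gibbs property: $\mu$ is a finite Borel measure and there is $C\ge1$ such that for every $x\in I_0''$, every $n\in\mathbb N$ and all $y\in I_n(x)$ (for which the sum is defined), $$\frac1C\le\frac{\mu(I_n(x))}{\exp\left(-nP(\Phi)+\sum_{j=0}^{n-1}\Phi(T^j(y))\right)}\le C .$$ Here $P(\Phi)\in\mathbb R$ is the pressure of $\Phi$, i.e. of its symbolic version on the full-shift coding $T$ (of summable variations): $P(\Phi)=\lim_{n\to\infty}\frac1n\log\sum_{T^nx=x}\exp\left(\sum_{j=0}^{n-1}\Phi(T^jx)\right)$. $\overline\Phi(x)=\lim_{n\to\infty}\frac1n\sum_{j=0}^{n-1}\Phi(T^j(x))$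 is the Birkhoff average at $x$, when this (finite) limit exists. $\delta_\mu(x)=\lim_{k\to\infty}\frac{\log\mu(I_k(x))}{\log|I_k(x)|}$ when the limit exists (Markov pointwise dimension). $\underline d_\mu(x)=\liminf_{r\to0}\frac{\log\mu(B(x,r))}{\log r}$ (lower pointwise dimension), where $B(x,r)$ is the ball of radius $r$ at $x$. *)

(* Defs.v *)
From HB Require Import structures.
From mathcomp Require Import all_boot all_order all_algebra.
From mathcomp Require Import all_classical all_reals all_analysis.

Set Implicit Arguments.
Unset Strict Implicit.
Unset Printing Implicit Defensive.

Import Order.TTheory GRing.Theory Num.Theory.
Import numFieldNormedType.Exports.

Local Open Scope classical_set_scope.
Local Open Scope ring_scope.

Section Intervals.
Context {R : realType}.
Implicit Types (A B L : set R) (f g : R -> R) (x : R).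

Definition nondegenerate_interval A : Prop :=
  is_interval A /\ exists a b, [/\ A a, A b & a < b].

(* Euclidean length; meant for bounded intervals only. *)
Definition length A : R := sup A - inf A.

(* [L] and [A] may share their common endpoint. *)
Definition adjacent_intervals L A : Prop :=
  (forall y z, L y -> A z -> y <= z) /\ is_interval (L `|` A).

Definition left_component A B : set R := [set y | A y /\ forall z, B z -> y < z].
Definition right_component A B : set R := [set y | A y /\ forall z, B z -> z < y].

(* Derivative relative to a set, one-sided at the endpoints of an interval that
   contains them: the maps of interest are only defined piecewise, and their
   values off the given set must play no role. *)
Definition difference_quotient f x : R -> R := fun y => (f y - f x) / (y - x).

Definition derivable_in A f x : Prop :=
  cvg (difference_quotient f x @ within A x^').

Definition derive_in A f x : R := lim (difference_quotient f x @ within A x^').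

Definition C1_in A f : Prop :=
  (forall x, A x -> derivable_in A f x) /\ {within A, continuous (derive_in A f)}.

Definition diffeomorphism A B f : Prop :=
  exists g, [/\ set_fun A B f, set_fun B A g,
    {in A, cancel f g} /\ {in B, cancel g f}, C1_in A f & C1_in B g].

End Intervals.

(* The partial map [T : I_0' -> I_0], [I_0' = \bigcup_i I1 i], is represented by
   a total function whose values outside [I_0'] are irrelevant. *)
Section EMR.
Context {R : realType} (I0 : set R) (I1 : nat -> set R) (T : R -> R).

Definition I0' : set R := \bigcup_i I1 i.

Definition EMR : Prop :=
  [/\ nondegenerate_interval I0 /\ I0 `<=` `[0, 1],
      trivIset setT I1,
      forall i, [/\ nondegenerate_interval (I1 i), I1 i `<=` I0 &
                    diffeomorphism (I1 i) I0 T],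
      1 < inf (\bigcup_i [set `|derive_in (I1 i) T x| | x in I1 i]) &
      exists2 K : R, 0 < K & forall i x y, I1 i x -> I1 i y ->
        `|derive_in (I1 i) T x / derive_in (I1 i) T y - 1| <= K * `|x - y|].

(* The points at which [T^n] is defined. *)
Definition iter_dom (n : nat) : set R :=
  [set x | forall j, (j < n)%N -> I0' (iter j T x)].

Definition I0'' : set R := [set x | forall n, I0' (iter n T x)].

Definition branch_domain (n : nat) (J : set R) : Prop :=
  [/\ nondegenerate_interval J, J `<=` iter_dom n & diffeomorphism J I0 (iter n T)].

Definition is_cylinder (n : nat) (x : R) (J : set R) : Prop :=
  [/\ branch_domain n J, J x &
      forall J', branch_domain n J' -> J' x -> J' `<=` J].

(* The largest branch domain of [T^n] around [x]; it exists, and is unique,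
   whenever [T] is EMR, [0 < n] and [x] is in [iter_dom n]. *)
Definition cylinder (n : nat) (x : R) : set R := xget set0 (is_cylinder n x).

Section Extension.
Variables (Il Ir : set R) (Ihat : nat -> set R -> set R).

(* [Ihat n J] is the extended interval attached to the [n]-cylinder [J]. *)

Definition I0hat : set R := Il `|` I0 `|` Ir.

Definition Ihat_at (n : nat) (x : R) : set R := Ihat n (cylinder n x).

Definition extension_setting : Prop :=
  [/\ nondegenerate_interval Il /\ Il `<=` `[0, 1],
      nondegenerate_interval Ir /\ Ir `<=` `[0, 1],
      adjacent_intervals Il I0 & adjacent_intervals I0 Ir].

(* [That] extends a single branch of [T^n]: the extended intervals of distinct
   cylinders may overlap. *)
Definition extension_property : Prop :=
  forall n x, (0 < n)%N -> iter_dom n x ->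
    [/\ nondegenerate_interval (Ihat_at n x),
        cylinder n x `<=` Ihat_at n x, Ihat_at n x `<=` I0hat &
        exists2 That : R -> R, diffeomorphism (Ihat_at n x) I0hat That &
          forall y, cylinder n x y -> That y = iter n T y].

Definition comparability : Prop :=
  exists2 K2 : R, 1 <= K2 & forall n x, (0 < n)%N -> iter_dom n x ->
    K2^-1 <= length (left_component (Ihat_at n x) (cylinder n x))
             / length (cylinder n x) <= K2 /\
    K2^-1 <= length (right_component (Ihat_at n x) (cylinder n x))
             / length (cylinder n x) <= K2.

Definition measure_comparability (mu : set R -> \bar R) : Prop :=
  exists2 K3 : R, 1 <= K3 & forall n x, (0 < n)%N -> iter_dom n x ->
    ((K3^-1)%:E <= mu (Ihat_at n x) / mu (cylinder n x) <= K3%:E)%E.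

End Extension.

(* A potential is a function on [I0''], given as a total function whose values
   outside [I0''] are irrelevant. *)
Section Potential.
Variable Phi : R -> R.

Definition birkhoff_sum (n : nat) (y : R) : R := \sum_(j < n) Phi (iter j T y).

Definition variation (n : nat) : \bar R :=
  ereal_sup [set d | exists y z,
    [/\ I0'' y, I0'' z, cylinder n y z & d = `|Phi y - Phi z|%:E]].

Definition summable_variations : Prop :=
  (\sum_(1 <= n <oo) variation n < +oo)%E.

Definition is_pressure (P : R) : Prop :=
  (fun n : nat => (lne (\esum_(y in [set y | I0'' y /\ iter n T y = y])
                          (expR (birkhoff_sum n y))%:E) / n%:R%:E)%E)
    @ \oo --> P%:E.

Definition gibbs (P : R) (mu : set R -> \bar R) : Prop :=
  exists2 C : R, 1 <= C & forall n x y, (0 < n)%N -> I0'' x ->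
    I0'' y -> cylinder n x y ->
    ((C^-1)%:E <= mu (cylinder n x)
                / (expR (- (n%:R * P) + birkhoff_sum n y))%:E <= C%:E)%E.

Definition birkhoff_average_exists (x : R) : Prop :=
  cvgn (fun n : nat => birkhoff_sum n x / n%:R).

End Potential.

Section Dimension.
Variable mu : set R -> \bar R.

Definition markov_quotient (x : R) (k : nat) : \bar R :=
  (lne (mu (cylinder k x)) / (ln (length (cylinder k x)))%:E)%E.

Definition markov_dimension_exists (x : R) : Prop := cvgn (markov_quotient x).

Definition markov_dimension (x : R) : \bar R := limn (markov_quotient x).

End Dimension.
End EMR.

Definition lower_pointwise_dimension {R : realType} (mu : set R -> \bar R)
    (x : R) : \bar R :=
  limf_einf (fun r : R => (lne (mu (ball x r)) / (ln r)%:E)%E) (0 : R)^'+.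

(* Main.v *)
Require Import Defs.
From HB Require Import structures.
From mathcomp Require Import all_boot all_order all_algebra.
From mathcomp Require Import all_classical all_reals all_analysis.
From mathcomp Require Import lra.

(** By (E1) and (E2) the ball B(x, r) lies in the extended cylinder \hat I_n(x)
    as soon as r <= |I_n(x)| / K2, so by (E3) mu(B(x, r)) <= K3 mu(I_n(x)).
    Choosing n with |I_{n+1}(x)| < K2 r <= |I_n(x)| bounds log r below by
    log |I_{n+1}(x)| up to a constant, and it remains to replace log mu(I_n(x))
    by log mu(I_{n+1}(x)).  By the Gibbs property their difference is
    S_{n+1} Phi(x) - S_n Phi(x) + O(1), which is o(n) because the Birkhoff
    averages converge, whereas - log |I_n(x)| grows at least linearly because T
    is uniformly expanding. *)

Set Implicit Arguments.
Unset Strict Implicit.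
Unset Printing Implicit Defensive.

Import Order.TTheory GRing.Theory Num.Theory.
Import numFieldNormedType.Exports.

Local Open Scope classical_set_scope.
Local Open Scope ring_scope.

(** * Calculus of derivatives relative to an interval *)

Section RelativeDerivative.
Context {R : realType}.
Implicit Types (A B C : set R) (f g h : R -> R) (x : R).

(** Properness makes limits along [within A x^'] unique, so a convergent difference quotient
    determines [derive_in]. *)
Lemma nondegenerate_interval_dnbhs_proper A x :
  nondegenerate_interval A -> A x -> ProperFilter (within A x^').
Proof.
move=> [Aint [a [b [Aa Ab ltab]]]] Ax; apply: Build_ProperFilter_ex => P.
case/nbhs_ballP => e /= e0 He.
have [c Ac cNx] : exists2 c, A c & c != x.
  have [xa|] := eqVneq a x; last by exists a.
  by exists b => //; rewrite -xa gt_eqF.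
have [ltcx|ltxc|cx] := ltgtP c x; last by rewrite cx eqxx in cNx.
- pose y := Num.max ((c + x) / 2) (x - e / 2).
  have yx : y < x by rewrite gt_max; apply/andP; split; lra.
  have yc : c < y by rewrite lt_max; apply/orP; left; lra.
  have ye : x - e / 2 <= y by rewrite le_max lexx orbT.
  have Ay : A y by apply: (Aint c x) => //; apply/andP; split; exact: ltW.
  exists y; apply: He => //; rewrite /ball /=.
    by rewrite gtr0_norm; lra.
  by rewrite lt_eqF.
- pose y := Num.min ((c + x) / 2) (x + e / 2).
  have yx : x < y by rewrite lt_min; apply/andP; split; lra.
  have yc : y < c by rewrite gt_min; apply/orP; left; lra.
  have ye : y <= x + e / 2 by rewrite ge_min lexx orbT.
  have Ay : A y by apply: (Aint x c) => //; apply/andP; split; exact: ltW.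
  exists y; apply: He => //; rewrite /ball /=.
    by rewrite ltr0_norm; lra.
  by rewrite gt_eqF.
Qed.

Lemma derivable_in_dnbhs_cvg A f x :
  derivable_in A f x -> f y @[y --> within A x^'] --> f x.
Proof.
move=> df.
have yx : y - x @[y --> within A x^'] --> 0.
  rewrite -(subrr x); apply: cvgB; last exact: cvg_cst.
  apply: cvg_trans (cvg_within _) _; exact: cvg_within.
have H : difference_quotient f x y * (y - x) + f x @[y --> within A x^'] --> f x.
  rewrite -[X in _ --> X]add0r -(mulr0 (derive_in A f x)).
  by apply: cvgD; [apply: cvgM|exact: cvg_cst].
apply: cvg_trans H; apply: fmap_within_eq => y _.
rewrite /difference_quotient; have [->|yNx] := eqVneq y x; first by lra.
by rewrite divfK ?subr_eq0// subrK.
Qed.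

Lemma derivable_in_continuous A f :
  (forall x, A x -> derivable_in A f x) -> {within A, continuous f}.
Proof.
move=> df; apply/subspace_continuousP => x Ax P Pfx.
have : nbhs x (fun y => y != x -> A y -> P (f y)).
  by have := derivable_in_dnbhs_cvg (df x Ax) Pfx.
apply: (@filterS _ (nbhs x)) => y H Ay.
by have [->|yNx] := eqVneq y x; [exact: nbhs_singleton Pfx|exact: H].
Qed.

Lemma derive_inE {A f x} (l : R) : nondegenerate_interval A -> A x ->
  difference_quotient f x y @[y --> within A x^'] --> l ->
  derivable_in A f x /\ derive_in A f x = l.
Proof.
move=> ndA Ax fl; have := nondegenerate_interval_dnbhs_proper ndA Ax => PF.
by split; [apply/cvg_ex; exists l|exact: cvg_lim fl].
Qed.

(** Along the finer filter of [A] the difference quotient keeps its limit, so both relative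
    derivatives agree on [A]. *)
Lemma C1_in_subset A B f : nondegenerate_interval A -> A `<=` B ->
  C1_in B f -> C1_in A f.
Proof.
move=> ndA AB [df cdf].
have H x : A x -> derivable_in A f x /\ derive_in A f x = derive_in B f x.
  move=> Ax; apply: derive_inE => //.
  apply: cvg_trans (df x (AB x Ax)).
  apply: cvg_app => P; exact: within_subset AB P.
split=> [x Ax|]; first by have [] := H x Ax.
apply: (@subspace_eq_continuous _ _ _ (derive_in B f)).
  by move=> x; rewrite inE => Ax; have [_ <-] := H x Ax.
exact: continuous_subspaceW AB cdf.
Qed.

(** Injectivity keeps [f y] away from [f x] for [y != x]: the quotient of [h] can be taken along
    [f], and the product of quotients never divides by zero. *)
Lemma derive_in_comp A B f h x :
  nondegenerate_interval A -> A x -> set_fun A B f -> {in A &, injective f} ->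
  derivable_in A f x -> derivable_in B h (f x) ->
  derivable_in A (h \o f) x /\
  derive_in A (h \o f) x = derive_in B h (f x) * derive_in A f x.
Proof.
move=> ndA Ax fAB finj df dh; apply: derive_inE => //.
have fx : f y @[y --> within A x^'] --> within B (f x)^'.
  move=> P /= PB.
  have : nbhs x (fun y => y != x -> A y -> f y != f x -> B (f y) -> P (f y)).
    by have := derivable_in_dnbhs_cvg df PB.
  apply: (@filterS _ (nbhs x)) => y H yNx Ay.
  apply: H => //; last exact: fAB.
  by apply: contra_neq yNx => fyx; apply: finj; rewrite ?inE.
have H := cvgM (@cvg_comp _ _ _ _ _ _ _ _ fx dh) df.
apply: cvg_trans (H _); apply: fmap_within_eq => y; rewrite inE => Ay.
rewrite /= /difference_quotient /=.
have [->|yNx] := eqVneq y x; first by rewrite !subrr !mul0r.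
rewrite mulrA divfK// subr_eq0; apply: contra_neq yNx => fyx.
by apply: finj; rewrite ?inE.
Qed.

Lemma C1_in_comp A B f h :
  nondegenerate_interval A -> set_fun A B f -> {in A &, injective f} ->
  C1_in A f -> C1_in B h -> C1_in A (h \o f).
Proof.
move=> ndA fAB finj [df cdf] [dh cdh].
have H x (Ax : A x) := derive_in_comp ndA Ax fAB finj (df x Ax) (dh _ (fAB _ Ax)).
split=> [x Ax|]; first by have [] := H x Ax.
apply: (@subspace_eq_continuous _ _ _
  ((fun x => derive_in B h (f x)) \* derive_in A f)).
  by move=> x; rewrite inE => Ax; have [_ E] := H x Ax; exact/esym/E.
have cf := derivable_in_continuous df.
apply/subspace_continuousP => x Ax.
move/subspace_continuousP in cf; move/subspace_continuousP in cdf.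
move/subspace_continuousP in cdh.
apply: cvgM; last exact: cdf.
apply: (@cvg_comp _ _ _ _ (derive_in B h) _ (within B (nbhs (f x)))).
  move=> P /= PB.
  have : nbhs x (fun y => A y -> B (f y) -> P (f y)) by exact: cf x Ax _ PB.
  by apply: (@filterS _ (nbhs x)) => y Hw Ay; apply: Hw => //; exact: fAB.
exact: cdh (fAB _ Ax).
Qed.

Lemma diffeomorphism_comp A B C f h :
  nondegenerate_interval A -> nondegenerate_interval C ->
  diffeomorphism A B f -> diffeomorphism B C h -> diffeomorphism A C (h \o f).
Proof.
move=> ndA ndC [f' [fAB f'BA [fK f'K] C1f C1f']] [h' [hBC h'CB [hK h'K] C1h C1h']].
exists (f' \o h'); split.
- by move=> x Ax; exact/hBC/fAB.
- by move=> x Ax; exact/f'BA/h'CB.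
- split=> x; rewrite inE => xin /=.
    by rewrite hK ?fK// inE//; exact: fAB.
  by rewrite f'K ?h'K// inE//; exact: h'CB.
- by apply: C1_in_comp C1h => //; exact: can_in_inj fK.
- by apply: C1_in_comp C1f' => //; exact: can_in_inj h'K.
Qed.

(** The set is the image of [C] under the inverse map: connected by continuity, nondegenerate by
    injectivity. It serves to pull a branch domain back through one branch of [T]. *)
Lemma diffeomorphism_preimage A B C f :
  nondegenerate_interval C -> C `<=` B -> diffeomorphism A B f ->
  nondegenerate_interval (A `&` f @^-1` C) /\
  diffeomorphism (A `&` f @^-1` C) C f.
Proof.
move=> ndC CB [g [fAB gBA [fK gK] C1f C1g]].
have AfE : A `&` f @^-1` C = g @` C.
  apply/seteqP; split=> [x [Ax Cfx]|_ [y Cy <-]].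
    by exists (f x) => //; rewrite fK ?inE.
  by split; [exact/gBA/CB|rewrite /= gK ?inE//; exact: CB].
have C1gC := C1_in_subset ndC CB C1g.
have ndAC : nondegenerate_interval (A `&` f @^-1` C).
  have [Cint [a [b [Ca Cb ltab]]]] := ndC.
  rewrite AfE; split.
    apply/connected_intervalP; apply: connected_continuous_connected.
      exact/connected_intervalP.
    exact: (derivable_in_continuous (proj1 C1gC)).
  have [ltg|ltg|geq] := ltgtP (g a) (g b).
  - by exists (g a), (g b); split.
  - by exists (g b), (g a); split.
  - suff ab : a = b by rewrite ab ltxx in ltab.
    by apply: (can_in_inj gK) => //; rewrite inE; exact: CB.
split=> //; exists g; split=> //.
- by move=> x [].
- by move=> y Cy; rewrite AfE; exists y.
- split=> x; rewrite inE.
    by case=> Ax _; rewrite fK ?inE.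
  by move=> Cx; rewrite gK ?inE//; exact: CB.
- by apply: C1_in_subset C1f.
Qed.

End RelativeDerivative.

(** * Expansion from a lower bound on the derivative *)

Section Expansion.
Context {R : realType}.
Implicit Types (A : set R) (f : R -> R) (x y z : R).

(** Strictly between two points of [A] the relative derivative is the ordinary two-sided one, as the
    mean value theorem requires. *)
Lemma is_derive_in A f y z x : is_interval A -> A y -> A z -> y < x < z ->
  derivable_in A f x -> is_derive x 1 f (derive_in A f x).
Proof.
move=> Aint Ay Az /andP[yx xz] df.
have hx : h + x @[h --> 0^'] --> within A x^'.
  move=> P /=; rewrite /within/= => /nbhs_ballP[e /= e0 He].
  pose d := Num.min e (Num.min (x - y) (z - x)).
  have d0 : 0 < d by rewrite !lt_min e0 !subr_gt0 yx.
  apply/nbhs_ballP; exists d => //= h; rewrite /ball/= sub0r normrN => hd hN0.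
  move: hd; rewrite !lt_min !ltr_norml => /and3P[he hy hz].
  apply: He; first by rewrite /ball/= opprD addrCA subrr addr0 normrN ltr_norml.
    by rewrite -subr_eq0 addrK.
  by apply: (Aint y z) => //; apply/andP; split; lra.
have H := @cvg_comp _ _ _ _ _ _ _ _ hx df.
have {}H : h^-1 *: ((f \o shift x) (h *: (1 : R)) - f x) @[h --> 0^']
    --> derive_in A f x.
  apply: cvg_trans H; apply: fmap_within_eq => h _.
  by rewrite /difference_quotient /= addrK mulrC /GRing.scale /= mulr1.
apply: DeriveDef; first by apply/cvg_ex; exists (derive_in A f x).
exact: cvg_lim H.
Qed.

Lemma expanding_in A f (M : R) : is_interval A ->
  (forall x, A x -> derivable_in A f x /\ M <= `|derive_in A f x|) ->
  forall y z, A y -> A z -> M * `|y - z| <= `|f y - f z|.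
Proof.
move=> Aint df.
suff H y z : A y -> A z -> y < z -> M * `|y - z| <= `|f y - f z|.
  move=> y z Ay Az; have [|zy|->] := ltgtP y z; first exact: H.
    by rewrite distrC [leRHS]distrC; exact: H.
  by rewrite !subrr normr0 mulr0.
move=> Ay Az yz.
have Ayz : `[y, z] `<=` A by move=> w; rewrite /= in_itv/=; exact: Aint.
have [|w|c cyz fyz] := @MVT _ f (derive_in A f) y z yz.
- move=> w; rewrite in_itv/= => wyz; apply: (is_derive_in Aint Ay Az wyz).
  apply: (df _ _).1; apply: Ayz; rewrite /= in_itv/=.
  by case/andP: wyz => *; rewrite !ltW.
- apply: continuous_subspaceW Ayz _ w; apply: derivable_in_continuous => u Au.
  exact: (df u Au).1.
- rewrite distrC [leRHS]distrC fyz normrM ler_wpM2r//.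
  apply: (df _ _).2; apply: Ayz; rewrite /= in_itv/=.
  by move: cyz; rewrite in_itv/= => /andP[*]; rewrite !ltW.
Qed.

Lemma le_length A (e : R) : A !=set0 ->
  (forall y z, A y -> A z -> z - y <= e) -> length A <= e.
Proof.
move=> A0 He; rewrite /length lerBlDr; apply: ge_sup => // z Az.
rewrite -lerBlDl; apply: lb_le_inf => // y Ay.
by rewrite lerBlDr -lerBlDl; exact: He.
Qed.

End Expansion.

(** * Cylinders and the exponential decay of their lengths *)

Section Cylinders.
Context {R : realType} (I0 : set R) (I1 : nat -> set R) (T : R -> R).
Hypothesis T_EMR : EMR I0 I1 T.

Lemma EMR_expanding : exists2 lambda : R, 1 < lambda &
  forall i y z, I1 i y -> I1 i z -> lambda * `|y - z| <= `|T y - T z|.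
Proof.
have [_ _ HI1 lam1 _] := T_EMR.
(* The infimum of |DT| over all branches serves as [lambda], which makes it uniform in [i]. *)
eexists; first exact: lam1.
move=> i; have [[Iint _] _ [g [_ _ _ [df _] _]]] := HI1 i.
apply: expanding_in => // x Ix; split; first exact: df.
apply: ge_inf; last by exists i => //; exists x.
by exists 0 => _ [j _] [y _ <-].
Qed.

(* [C] is built as the set of points with the same itinerary as [x] up to time
   [n], so that every step of the orbit stays in a single branch of [T]. *)
Lemma branch_domain_expanding : exists2 lambda : R, 1 < lambda &
  forall n x, iter_dom I1 T n.+1 x -> exists C,
    [/\ branch_domain I0 I1 T n.+1 C, C x & forall y z, C y -> C z ->
        lambda ^+ n.+1 * `|y - z| <= `|iter n.+1 T y - iter n.+1 T z|].
Proof.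
have [[ndI0 _] _ HI1 _ _] := T_EMR.
have [lambda lam1 expT] := EMR_expanding.
exists lambda => //; elim=> [|n IH] x xdom.
  have [i _ Iix] := xdom 0%N erefl.
  have [ndI _ dI] := HI1 i.
  exists (I1 i); split=> //; last by move=> y z; rewrite expr1; exact: expT.
  by split=> // y Iiy [|//] _; exists i.
have [i _ Iix] := xdom 0%N erefl.
have [_ _ dI] := HI1 i.
(* The itinerary of [x] is its branch [i] followed by the itinerary of [T x], so the set for [T x]
   is pulled back through [I1 i]. *)
have [|C [[ndC Cdom dC] CTx expC]] := IH (T x).
  by move=> j jn; rewrite -iterSr; exact: xdom.
have CI0 : C `<=` I0.
  move=> y Cy; have [k _ Iky] := Cdom y Cy 0%N erefl.
  by have [_ kI0 _] := HI1 k; exact: kI0.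
have [ndD dD] := diffeomorphism_preimage ndC CI0 dI.
exists (I1 i `&` T @^-1` C); split=> //.
  split=> //.
    move=> y [Iiy CTy] [|j] jn; first by exists i.
    by rewrite iterSr; exact: Cdom CTy _ jn.
  have -> : iter n.+2 T = iter n.+1 T \o T by apply/funext => y; rewrite iterSr.
  exact: diffeomorphism_comp ndD ndI0 dD dC.
move=> y z [Iiy Cy] [Iiz Cz]; rewrite !(iterSr n.+1).
apply: le_trans (expC _ _ Cy Cz).
rewrite exprSr -mulrA ler_wpM2l//; last exact: expT Iiy Iiz.
by rewrite exprn_ge0// (le_trans ler01)// ltW.
Qed.

(* Maximality gives [C `<=` J]; both are mapped injectively onto [I0]. *)
Lemma branch_domain_cylinder n x (C J : set R) :
  branch_domain I0 I1 T n C -> C x -> is_cylinder I0 I1 T n x J -> J = C.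
Proof.
move=> HC Cx [[_ _ [g [JI0 _ [gK _] _ _]]] Jx Jmax].
have CJ := Jmax C HC Cx; apply/seteqP; split=> // y Jy.
have [_ _ [g' [_ g'C [_ g'K] _ _]]] := HC.
have Ty := JI0 y Jy; have Cg' := g'C _ Ty.
rewrite -(gK y) ?inE// -(g'K (iter n T y)) ?inE// gK// inE.
exact: CJ.
Qed.

(** The iterate stretches distances in the cylinder by the power of [lambda], yet its values stay in
    [I0], a subset of [0, 1]. *)
Lemma length_cylinder_decay : exists2 lambda : R, 1 < lambda &
  forall n x J, iter_dom I1 T n.+1 x -> is_cylinder I0 I1 T n.+1 x J ->
    length J <= lambda ^- n.+1.
Proof.
have [[_ I01] _ _ _ _] := T_EMR.
have [lambda lam1 H] := branch_domain_expanding.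
exists lambda => // n x J xdom cylJ; have [C [HC Cx expC]] := H n x xdom.
rewrite (branch_domain_cylinder HC Cx cylJ).
have lam0 : 0 < lambda ^+ n.+1 by rewrite exprn_gt0// (lt_trans _ lam1).
have [_ _ [g [CI0 _ _ _ _]]] := HC.
apply: le_length => [|y z Cy Cz]; first by exists x.
rewrite -(ler_pM2l lam0) mulfV ?gt_eqF//.
apply: (@le_trans _ _ (lambda ^+ n.+1 * `|z - y|)).
  by rewrite ler_pM2l// ler_norm.
apply: le_trans (expC _ _ Cz Cy) _.
have := I01 _ (CI0 _ Cz); have := I01 _ (CI0 _ Cy).
rewrite /= !in_itv/= => /andP[? ?] /andP[? ?].
by rewrite ler_norml; apply/andP; split; lra.
Qed.

End Cylinders.

(** * Negligible increments and the choice of a scale *)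

Section Asymptotics.
Context {R : realType}.

(* The convergence of [S n / n] makes the increments of [a] negligible compared
   to [l n >= c * n], which absorbs the shift of index within [eta * l n.+1]. *)
Lemma eventually_le_consecutive (a l S : nat -> R) (P c k k2 k3 e eta : R) :
  0 < c -> 0 < eta ->
  (forall n, c * n.+1%:R <= l n.+1) ->
  (forall n, `|a n.+1 - (- (n.+1%:R * P) + S n.+1)| <= k) ->
  cvgn (fun n => S n / n%:R) ->
  (\forall n \near \oo, (e + eta) * l n <= - a n) ->
  \forall n \near \oo, e * (l n + k2) <= - a n - k3 /\
                       e * (l n.+1 + k2) <= - a n - k3.
Proof.
move=> c0 eta0 lc aS /cvg_ex[/= beta Sbeta] ea.
(* With this [d], the slack [eta * l n] covers [4 * (d * n)]: two shares pay for the Birkhoff errors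
   at [n] and [n.+1], another for [B]. *)
pose d := eta * c / 4.
have d0 : 0 < d by rewrite divr_gt0// mulr_gt0.
have Sd : \forall n \near \oo, `|S n - n%:R * beta| <= d * n%:R.
  have /cvgrPdist_le/(_ _ d0) Sb := Sbeta.
  near=> n.
  have n0 : 0 < n%:R :> R by rewrite ltr0n; near: n; exact: nbhs_infty_gt.
  have -> : S n - n%:R * beta = (S n / n%:R - beta) * n%:R.
    by rewrite mulrBl divfK ?gt_eqF// [beta * _]mulrC.
  rewrite normrM [`|n%:R|]ger0_norm// ler_wpM2r// distrC.
  by near: n.
have shift (Q : set nat) :
    (\forall n \near \oo, Q n) -> \forall n \near \oo, Q n.+1.
  by case=> N _ QN; exists N => // n /= Nn; apply: QN; exact: leqW.
(* [B] gathers what does not grow with [n]: the jump from [a n] to [a n.+1] costs |P| + |beta| + 2k,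
   and the last [d] comes from [d * n.+1]. *)
pose B := `|P| + `|beta| + 2 * k + `|k3| + `|e * k2| + d.
near=> n.
have ea0 : (e + eta) * l n <= - a n by near: n.
have ea1 : (e + eta) * l n.+1 <= - a n.+1.
  by near: n; exact: shift ea.
have Sd0 : `|S n - n%:R * beta| <= d * n%:R by near: n.
have Sd1 : `|S n.+1 - n.+1%:R * beta| <= d * n.+1%:R.
  by near: n; exact: shift Sd.
have dB : B <= d * n%:R.
  rewrite mulrC -ler_pdivrMr//; near: n; exact: nbhs_infty_ger.
have n0 : (0 < n)%N by near: n; exact: nbhs_infty_gt.
have etal m : 4 * (d * m.+1%:R) <= eta * l m.+1.
  rewrite mulrA /d [4 * _]mulrC divfK// -mulrA ler_pM2l//.
(* [aS] speaks of positive indices only, so [a n] is reached through [n.-1]. *)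
have := aS n; have := aS n.-1; rewrite prednK// => aS0 aS1.
have el0 := etal n.-1; rewrite prednK// in el0.
have el1 := etal n.
have B1 := ler_norm P; have B2 := ler_norm (- P).
have B3 := ler_norm beta; have B4 := ler_norm (- beta).
have B5 := ler_norm k3; have B6 := ler_norm (e * k2).
rewrite !normrN in B2 B4.
move: Sd0 Sd1 aS0 aS1; rewrite !ler_norml.
move=> /andP[? ?] /andP[? ?] /andP[? ?] /andP[? ?].
rewrite -!natr1 in ea1 el1 * => *.
have dn : d * (n%:R + 1) = d * n%:R + d by rewrite mulrDr mulr1.
have Pn : (n%:R + 1) * P = n%:R * P + P by rewrite mulrDl mul1r.
have bn : (n%:R + 1) * beta = n%:R * beta + beta by rewrite mulrDl mul1r.
have E0 : (e + eta) * l n = e * l n + eta * l n by rewrite mulrDl.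
have E1 : (e + eta) * l n.+1 = e * l n.+1 + eta * l n.+1 by rewrite mulrDl.
rewrite !mulrDr; rewrite /B in dB.
have k0 : 0 <= k by apply: le_trans (aS 0%N).
split; lra.
Unshelve. all: by end_near. Qed.

(** Take the least [n >= N] with [u n.+1 < r]: either [n = N], or minimality gives [r <= u n]. *)
Lemma exists_last_before (u : nat -> R) (r : R) (N : nat) :
  (exists2 n, (N <= n)%N & u n.+1 < r) -> r <= u N ->
  exists n, [/\ (N <= n)%N, r <= u n & u n.+1 < r].
Proof.
move=> [M NM uM] rN.
have ex : exists n, (N <= n)%N && (u n.+1 < r) by exists M; rewrite NM.
have [n /andP[Nn un] nmin] := ex_minnP ex.
exists n; split=> //; move: Nn; rewrite leq_eqVlt => /predU1P[<- //|].
case: n un nmin => // n _ nmin; rewrite ltnS leNgt => Nn; apply/negP => un.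
by have := nmin n; rewrite Nn un ltnn => /(_ isT).
Qed.

End Asymptotics.

(** * Balls inside extended cylinders *)

Section Balls.
Context {R : realType}.
Implicit Types (J H : set R) (x r : R).

Lemma length_set0 : length (set0 : set R) = 0.
Proof. by rewrite /length sup0 inf0 subrr. Qed.

Lemma length_gt0 J : has_lbound J -> has_ubound J -> nondegenerate_interval J ->
  0 < length J.
Proof.
move=> lbJ ubJ [_ [a [b [Ja Jb ltab]]]]; rewrite /length subr_gt0.
apply: (@le_lt_trans _ _ a); first exact: ge_inf.
by apply: lt_le_trans ltab _; exact: ub_le_sup.
Qed.

(** Each component lies on one side of [x] and has length at least [r], so it reaches beyond any
    point of the ball on that side; convexity of [H] does the rest. *)
Lemma ball_subset_components J H x r : is_interval H ->
  J `<=` H -> J x -> 0 < r ->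
  r <= length (left_component H J) -> r <= length (right_component H J) ->
  ball x r `<=` H.
Proof.
move=> Hint JH Jx r0 rl rr y; rewrite /ball/= => xyr.
have Hx := JH x Jx.
have [yx|xy] := leP y x.
- set L := left_component H J in rl.
  (* An empty component would have length 0, by the default values of [sup] and [inf], against
     [0 < r]. *)
  have L0 : L !=set0.
    by apply/set0P/negP => /eqP L0; rewrite L0 length_set0 leNgt r0 in rl.
  have infL : inf L < y.
    have supL : sup L <= x by apply: ge_sup => // w [_ wJ]; exact/ltW/wJ.
    move: rl xyr; rewrite /length ger0_norm ?subr_ge0//; lra.
  have [w [Hw _] wy] := inf_lt L0 infL.
  by apply: (Hint w x) => //; rewrite (ltW wy).
- set L := right_component H J in rr.
  have L0 : L !=set0.
    by apply/set0P/negP => /eqP L0; rewrite L0 length_set0 leNgt r0 in rr.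
  have supL : y < sup L.
    have infL : x <= inf L by apply: lb_le_inf => // w [_ wJ]; exact/ltW/wJ.
    move: rr xyr; rewrite /length ltr0_norm ?subr_lt0//; lra.
  have [w [Hw _] yw] := sup_gt L0 supL.
  by apply: (Hint x w) => //; rewrite (ltW xy) ltW.
Qed.

End Balls.

(** * Logarithmic quotients in the extended reals *)

Section ExtendedReals.
Context {R : realType}.

Lemma exists_between_ereal (a b : \bar R) : (a < b)%E ->
  exists r : R, (a < r%:E < b)%E.
Proof.
case: a b => [a| |] [b| |]//.
- rewrite lte_fin => ab; exists ((a + b) / 2).
  by rewrite !lte_fin; apply/andP; split; lra.
- by move=> _; exists (a + 1); rewrite lte_fin ltry ltrDl ltr01.
- by move=> _; exists (b - 1); rewrite lte_fin ltNyr gtrBl ltr01.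
- by move=> _; exists 0; rewrite ltNyr ltry.
Qed.

Lemma le_lne_div (e u s : R) (y : \bar R) : 0 < s < 1 -> 0 < u ->
  (0%E <= y <= u%:E)%E -> ln u <= e * ln s -> (e%:E <= lne y / (ln s)%:E)%E.
Proof.
move=> s01 u0 /andP[y0 yu] us.
have lns : ln s < 0 by exact: ln_lt0.
rewrite inver lt_eqF//.
(* For [y = 0] the logarithm is -oo, and its quotient by the negative [ln s] is +oo. *)
have [->|yN0] := eqVneq y 0%E.
  by rewrite le0_lneNy// mulNyr ltr0_sg ?invr_lt0// mulN1e leey.
have [v yE] : exists v, y = v%:E.
  by move: y y0 yu {yN0} => [v| |]// _ _; exists v.
have v0 : 0 < v by rewrite -lte_fin -yE lt_def yN0.
rewrite yE lne_EFin// -EFinM lee_fin ler_ndivlMr//.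
apply: le_trans us.
by rewrite ler_ln ?posrE//; rewrite yE lee_fin in yu.
Qed.

End ExtendedReals.

(** * Comparison of the two dimensions at [x] *)

Theorem lemmaC2 (R : realType)
    (I0 : set R) (I1 : nat -> set R) (T : R -> R)
    (Il Ir : set R) (Ihat : nat -> set R -> set R)
    (mu : {finite_measure set (measurableTypeR R) -> \bar R})
    (Phi : R -> R) (P : R) (x : R)
    (T_EMR : EMR I0 I1 T)
    (adjacent : extension_setting I0 Il Ir)
    (E1 : extension_property I0 I1 T Il Ir Ihat)
    (E2 : comparability I0 I1 T Ihat)
    (E3 : measure_comparability I0 I1 T Ihat mu)
    (mu_on_I0hat : mu (~` I0hat I0 Il Ir) = 0%E)
    (Phi_summable : summable_variations I0 I1 T Phi)
    (P_pressure : is_pressure I1 T Phi P)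
    (mu_gibbs : gibbs I0 I1 T Phi P mu)
    (x_I0'' : I0'' I1 T x)
    (delta_exists : markov_dimension_exists I0 I1 T mu x)
    (average_exists : birkhoff_average_exists T Phi x) :
  (markov_dimension I0 I1 T mu x <= lower_pointwise_dimension mu x)%E.
Proof.
have xdom n : iter_dom I1 T n x by move=> j _; exact: x_I0''.
have [K2 K21 {}E2] := E2; have [K3 K31 {}E3] := E3.
have [C C1 gibbsC] := mu_gibbs.
have K20 : 0 < K2 by apply: lt_le_trans K21.
have K30 : 0 < K3 by apply: lt_le_trans K31.
have C0 : 0 < C by apply: lt_le_trans C1.
pose J n := cylinder I0 I1 T n x.
pose H n := Ihat_at I0 I1 T Ihat n x.
have cylJ n : is_cylinder I0 I1 T n.+1 x (J n.+1).
  (* Otherwise [cylinder] is the junk value [set0], contradicting (E2). *)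
  rewrite /J /cylinder; case: xgetP => // nocyl.
  have [/andP[+ _] _] := E2 n.+1 x isT (xdom _).
  rewrite {2}/cylinder xgetPN// length_set0 invr0 mulr0 => K2le0.
  by move: K2le0; rewrite leNgt invr_gt0 K20.
(* Boundedness matters because [length] is built from [sup] and [inf]; it yields the positivity
   [L0]. *)
have Hb : I0hat I0 Il Ir `<=` `[0, 1].
  have [[_ I01] _ _ _ _] := T_EMR; have [[_ Il01] [_ Ir01] _ _] := adjacent.
  by rewrite /I0hat !subUset.
have E1n n := E1 n.+1 x isT (xdom _).
have JH n : J n.+1 `<=` H n.+1 by have [] := E1n n.
have H01 n : H n.+1 `<=` `[0, 1].
  by have [_ _ HI _] := E1n n; exact: subset_trans Hb.
have Hint n : is_interval (H n.+1) by have [[]] := E1n n.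
have L0 n : 0 < length (J n.+1).
  have [[ndJ _ _] _ _] := cylJ n; apply: length_gt0 => //.
    by exists 0 => y /JH/H01; rewrite /= in_itv/= => /andP[].
  by exists 1 => y /JH/H01; rewrite /= in_itv/= => /andP[].
have ballH n r : 0 < r <= length (J n.+1) / K2 -> ball x r `<=` H n.+1.
  move=> /andP[r0 rL].
  have [/andP[+ _] /andP[+ _]] := E2 n.+1 x isT (xdom _).
  rewrite !(ler_pdivlMr _ _ (L0 n)) ![K2^-1 * _]mulrC => Ll Lr.
  have [_ Jx _] := cylJ n.
  by apply: (ball_subset_components _ (@JH n)) => //; exact: le_trans rL _.
have mJ n : measurable (J n.+1 : set (measurableTypeR R)).
  by apply: measurable_realfun.is_interval_measurable; have [[[]]] := cylJ n.
have mH n : measurable (H n.+1 : set (measurableTypeR R)).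
  exact: measurable_realfun.is_interval_measurable.
pose m n := fine (mu (J n)).
have muJ n : mu (J n.+1) = (m n.+1)%:E by rewrite fineK// fin_num_measure.
pose S n := birkhoff_sum T Phi n x.
have gibbsm n : C^-1 <= m n.+1 / expR (- (n.+1%:R * P) + S n.+1) <= C.
  have [_ Jx _] := cylJ n.
  have := gibbsC n.+1 x x isT x_I0'' x_I0'' Jx.
  by rewrite -/(J n.+1) muJ inver gt_eqF ?expR_gt0// -EFinM !lee_fin.
have m0 n : 0 < m n.+1.
  have /andP[+ _] := gibbsm n; rewrite ler_pdivlMr ?expR_gt0//.
  by apply: lt_le_trans; rewrite mulr_gt0 ?invr_gt0 ?expR_gt0.
have lnm n : `|ln (m n.+1) - (- (n.+1%:R * P) + S n.+1)| <= ln C.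
  have /andP[lo up] := gibbsm n.
  have E : ln (m n.+1) - (- (n.+1%:R * P) + S n.+1)
         = ln (m n.+1 / expR (- (n.+1%:R * P) + S n.+1)).
    by rewrite ln_div ?posrE ?expR_gt0// expRK.
  have q0 : 0 < m n.+1 / expR (- (n.+1%:R * P) + S n.+1).
    by rewrite divr_gt0 ?expR_gt0.
  by rewrite E ler_norml -lnV ?posrE// !ler_ln ?posrE ?invr_gt0// lo.
have muH n : (mu (H n.+1) <= (K3 * m n.+1)%:E)%E.
  have /andP[_ +] := E3 n.+1 x isT (xdom _).
  by rewrite -/(J n.+1) muJ inver gt_eqF// lee_pdivrMr.
have [lambda lam1 lenJ] := length_cylinder_decay T_EMR.
have {}lenJ n := lenJ n x _ (xdom _) (cylJ n).
have lam0 : 0 < lambda by apply: lt_trans lam1.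
pose l n := - ln (length (J n)).
have lln n : ln lambda * n.+1%:R <= l n.+1.
  rewrite /l lerNr mulr_natr -lnXn// -lnV ?posrE ?exprn_gt0//.
  by rewrite ler_ln ?posrE ?invr_gt0 ?exprn_gt0// lenJ.
have lnlam : 0 < ln lambda by exact: ln_gt0.
(* By contradiction, reals [e < e'] are put strictly between the two dimensions; the gap [e' - e] is
   the slack [eta] that absorbs all errors. *)
rewrite leNgt; apply/negP => /exists_between_ereal[e /andP[Le ed]].
have [e' /andP[ee' e'd]] := exists_between_ereal ed.
rewrite lte_fin in ee'.
have l0 n : 0 < l n.+1 by apply: lt_le_trans (lln n); rewrite mulr_gt0.
have near_e' : \forall n \near \oo, (e + (e' - e)) * l n <= - ln (m n).
  have := delta_exists _ (open_ereal_gt' e'd); apply: filterS2 (nbhs_infty_gt 0).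
  move=> [//|n] _; rewrite /= /markov_quotient -/(J n.+1) muJ lne_EFin// inver.
  have -> : ln (length (J n.+1)) = - l n.+1 by rewrite opprK.
  rewrite oppr_eq0 gt_eqF// -EFinM lte_fin invrN mulrN -mulNr.
  by rewrite ltr_pdivlMr// addrC subrK => /ltW.
have eta0 : 0 < e' - e by rewrite subr_gt0.
have [N _ HN] := eventually_le_consecutive (ln K2) (ln K3) lnlam eta0 lln lnm
  average_exists near_e'.
move: Le; rewrite ltNge => /negP; apply.
rewrite /lower_pointwise_dimension limf_einfE.
(* The lower limit is a supremum of infima over right neighbourhoods of 0, so the bound by [e] on
   [V] suffices; [r < 1] makes [ln r] negative. *)
pose V := [set r : R | 0 < r < 1 /\ r <= length (J N.+1) / K2].
apply: (@le_trans _ _ (ereal_inf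
  ((fun r : R => (lne (mu (ball x r)) / (ln r)%:E)%E) @` V))); last first.
  apply: ereal_sup_ubound; exists V => //.
  near=> r; split; first by apply/andP; split.
  near: r; apply: nbhs_right_le; exact: divr_gt0.
apply: le_ereal_inf_tmp => _ [r [/andP[r0 r1] rN] <-].
(* Orders are shifted by one since only cylinders of positive order are controlled. *)
have [n [Nn rn rn1]] : exists n, [/\ (N <= n)%N,
    r <= length (J n.+1) / K2 & length (J n.+2) / K2 < r].
  apply: (@exists_last_before _ (fun n => length (J n.+1) / K2)) => //.
  (* This threshold is where the linear growth of [l] overtakes [- ln r - ln K2], so some cylinder
     is small enough. *)
  have [M _ HM] := nbhs_infty_ger ((- ln r - ln K2) / ln lambda).
  exists (maxn N M); first exact: leq_maxl.
  have := HM (maxn N M) (leq_maxr _ _); rewrite /= ler_pdivrMr// => lnrn.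
  rewrite -ltr_ln ?posrE ?divr_gt0// ln_div ?posrE//.
  have := lln (maxn N M).+1.
  rewrite /l -!natr1 !mulrDr mulr1 [ln lambda * _]mulrC; lra.
have [en en1] := HN n.+1 (leqW Nn).
have lnr1 : - ln r <= l n.+2 + ln K2.
  by rewrite lerNl opprD opprK -ln_div ?posrE// ler_ln ?posrE ?divr_gt0// ltW.
have lnr0 : l n.+1 + ln K2 <= - ln r.
  by rewrite lerNr opprD opprK -ln_div ?posrE// ler_ln ?posrE ?divr_gt0.
apply: (@le_lne_div _ _ (K3 * m n.+1)).
- by rewrite r0.
- by rewrite mulr_gt0.
- rewrite measure_ge0/=; apply: le_trans (muH n).
  apply: le_measure; rewrite ?inE//; first exact: measurable_realfun.measurable_ball.
  by apply: ballH; rewrite r0.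
rewrite lnM ?posrE//.
rewrite -[ln r]opprK mulrN lerNr opprD addrC.
(* [e] may be negative; its sign decides whether [- ln r] is bounded above through order [n.+2] or
   below through order [n.+1], hence the two estimates [en1] and [en]. *)
have [e0|/ltW e0] := leP 0 e.
  exact: le_trans (ler_wpM2l e0 lnr1) en1.
exact: le_trans (ler_wnM2l e0 lnr0) en.
Unshelve. all: by end_near. Qed.
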